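(* The image of the tangential variety $\mathrm{Tan}((\mathbb{P}^1)^n)$ in the space $\mathbb{C}^{2^n-n-1}$ of higher cumulants (i.e. the Zariski closure of the set of vectors $(k_I)_{|I|\ge2}$ of points of $\mathrm{Tan}((\mathbb{P}^1)^n)$ lying in the chart $\mu_\emptyset=1$) is isomorphic to the $n$-dimensional affine toric variety parametrized by all square-free monomials of degree $\ge2$, i.e. the Zariski closure in $\mathbb{C}^{2^n-n-1}$ of the image of $(s_1,\ldots,s_n)\mapsto\big(\prod_{i\in I}s_i\big)_{I\subseteq[n],\,|I|\ge2}$.
   Context: Identify $\mathbb{C}^{2\times\cdots\times2}$ ($n$ factors) with tables $(p_I)_{I\subseteq[n]}$ and $\mathbb{P}^{2^n-1}$ with its projectivization. The Segre variety $(\mathbb{P}^1)^n\subset\mathbb{P}^{2^n-1}$ consists of the rank-one tensors $a^{(1)}\otimes\cdots\otimes a^{(n)}$. $\mathrm{Tan}((\mathbb{P}^1)^n)$ is the Zariski closure of the set of points lying on a line tangent to $(\mathbb{P}^1)^n$. Moment coordinates are $\mu_I=\sum_{J\supseteq I}p_J$. On the chart $\mu_\emptyset=1$, the cumulants $k_I$ ($I\ne\emptyset$) are the coefficients of $\log\big(\sum_I\mu_I\prod_{i\in I}x_i\big)$ computed modulo $\langle x_1^2,\ldots,x_n^2\rangle$ (equivalently $k_I=\sum_{\pi\in\Pi(I)}(-1)^{|\pi|-1}(|\pi|-1)!\prod_{B\in\pi}\mu_B$ over set partitions $\pi$ of $I$); those with $|I|\ge2$ are the higher cumulants, giving coordinates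 on $\mathbb{C}^{2^n-n-1}$.
   Formalization: The isomorphism is stated for all n ≥ 1 (Tan is empty for n = 0), and ''n-dimensional'' is stated only for n ≥ 3, since for n = 1, 2 the toric variety lies in C^0, C^1 and has dimension 0, 1. *)

(* Defs.v *)
From HB Require Import structures.
From mathcomp Require Import all_boot all_order all_algebra.
From mathcomp Require Import reals complex mpoly.

Set Implicit Arguments.
Unset Strict Implicit.
Unset Printing Implicit Defensive.

Import GRing.Theory.
Local Open Scope ring_scope.

(* Affine space with coordinates indexed by a finite type T.  Its coordinate  *)
(* ring is {mpoly K[#|T|]}, variable number j standing for the coordinate     *)
(* enum_val j of T.                                                           *)
Definition affine_space (K : fieldType) (T : finType) := {ffun T -> K}.

Definition peval (K : fieldType) (T : finType)
    (p : {mpoly K[#|T|]}) (v : affine_space K T) : K :=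
  p.@[fun j : 'I_#|T| => v (enum_val j)].

Definition vanishes_on (K : fieldType) (T : finType)
    (p : {mpoly K[#|T|]}) (S : affine_space K T -> Prop) : Prop :=
  forall v, S v -> peval p v = 0.

Definition zariski_closure (K : fieldType) (T : finType)
    (S : affine_space K T -> Prop) : affine_space K T -> Prop :=
  fun v => forall p, vanishes_on p S -> peval p v = 0.

Definition zariski_closed (K : fieldType) (T : finType)
    (S : affine_space K T -> Prop) : Prop :=
  forall v, zariski_closure S v -> S v.

Definition irreducible (K : fieldType) (T : finType)
    (Z : affine_space K T -> Prop) : Prop :=
  (exists v, Z v) /\
  forall A B : affine_space K T -> Prop,
    zariski_closed A -> zariski_closed B ->
    (forall v, Z v -> A v \/ B v) ->
    (forall v, Z v -> A v) \/ (forall v, Z v -> B v).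

(* Z 0, ..., Z m is a strictly increasing chain of irreducible closed subsets *)
(* of X; the values of Z beyond m are irrelevant.                             *)
Definition irreducible_chain (K : fieldType) (T : finType)
    (X : affine_space K T -> Prop) (m : nat)
    (Z : nat -> affine_space K T -> Prop) : Prop :=
  (forall i, (i <= m)%N ->
     [/\ zariski_closed (Z i), irreducible (Z i) & forall v, Z i v -> X v]) /\
  (forall i, (i < m)%N ->
     (forall v, Z i v -> Z i.+1 v) /\ exists v, Z i.+1 v /\ ~ Z i v).

Definition has_dimension (K : fieldType) (T : finType)
    (X : affine_space K T -> Prop) (d : nat) : Prop :=
  (exists Z, irreducible_chain X d Z) /\
  (forall m Z, irreducible_chain X m Z -> (m <= d)%N).

Definition polynomial_map (K : fieldType) (T U : finType)
    (f : U -> {mpoly K[#|T|]}) (v : affine_space K T) : affine_space K U :=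
  [ffun u => peval (f u) v].

Definition isomorphic (K : fieldType) (T U : finType)
    (X : affine_space K T -> Prop) (Y : affine_space K U -> Prop) : Prop :=
  exists (f : U -> {mpoly K[#|T|]}) (g : T -> {mpoly K[#|U|]}),
    [/\ forall x, X x -> Y (polynomial_map f x),
        forall y, Y y -> X (polynomial_map g y),
        forall x, X x -> polynomial_map g (polynomial_map f x) = x
      & forall y, Y y -> polynomial_map f (polynomial_map g y) = y].

(* A point of the projective space P(K^T) is represented by any of its        *)
(* nonzero homogeneous coordinate vectors, and a subset of P(K^T) by the set  *)
(* of all representatives of its points.                                      *)
Definition nonzero (K : fieldType) (T : finType) (v : affine_space K T) : Prop :=
  exists t, v t != 0.

Definition projective_closure (K : fieldType) (T : finType)
    (S : affine_space K T -> Prop) : affine_space K T -> Prop :=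
  fun v => nonzero v /\
    forall (d : nat) (F : {mpoly K[#|T|]}),
      F \is d.-homog -> vanishes_on F S -> peval F v = 0.

(* The affine cone over the embedded projective tangent space of X at x.      *)
Definition embedded_tangent_space (K : fieldType) (T : finType)
    (X : affine_space K T -> Prop) (x : affine_space K T) :
    affine_space K T -> Prop :=
  fun y => forall (d : nat) (F : {mpoly K[#|T|]}),
    F \is d.-homog -> vanishes_on F X ->
    \sum_(j < #|T|) peval F^`M(j) x * y (enum_val j) = 0.

(* Linear independence of x and y makes their span the cone over a line.      *)
Definition on_tangent_line (K : fieldType) (T : finType)
    (X : affine_space K T -> Prop) : affine_space K T -> Prop :=
  fun z => nonzero z /\
    exists x y : affine_space K T,
      [/\ X x,
          embedded_tangent_space X x y,
          (forall a b : K, (forall t, a * x t + b * y t = 0) -> a = 0 /\ b = 0)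
        & exists a b : K, forall t, z t = a * x t + b * y t].

Definition tangential_variety (K : fieldType) (T : finType)
    (X : affine_space K T -> Prop) : affine_space K T -> Prop :=
  projective_closure (on_tangent_line X).

(* The two coordinates of the i-th factor are indexed by bool; the entry p_I  *)
(* of a table uses the coordinate true of the factors i \in I and the         *)
(* coordinate false of the others.                                            *)
Definition segre (K : fieldType) (n : nat) :
    affine_space K {set 'I_n} -> Prop :=
  fun p => exists a : 'I_n -> bool -> K,
    (forall i, exists b, a i b != 0) /\
    forall I, p I = \prod_(i < n) a i (i \in I).

Definition moment (K : fieldType) (n : nat)
    (p : affine_space K {set 'I_n}) (I : {set 'I_n}) : K :=
  \sum_(J : {set 'I_n} | I \subset J) p J.

Definition moment_gf (K : fieldType) (n : nat)
    (p : affine_space K {set 'I_n}) : {mpoly K[n]} :=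
  \sum_(I : {set 'I_n}) moment p I *: \prod_(i in I) 'X_i.

(* Modulo <x_1^2, ..., x_n^2> a polynomial g without constant term satisfies  *)
(* g ^+ m = 0 for m > n, so log (1 + g) is given by the first n terms of the  *)
(* Mercator series.                                                           *)
Definition trunc_log (K : fieldType) (n : nat) (f : {mpoly K[n]}) :
    {mpoly K[n]} :=
  \sum_(1 <= m < n.+1) ((-1) ^+ m.-1 / m%:R) *: (f - 1) ^+ m.

(* Reduction modulo <x_1^2, ..., x_n^2> leaves the coefficient of the         *)
(* square-free monomial \prod_(i in I) x_i unchanged.                         *)
Definition cumulant (K : fieldType) (n : nat)
    (p : affine_space K {set 'I_n}) (I : {set 'I_n}) : K :=
  (trunc_log (moment_gf p))@_[multinom nat_of_bool (i \in I) | i < n].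

Definition higher_index (n : nat) : finType :=
  {I : {set 'I_n} | (1 < #|I|)%N}.

Definition higher_cumulants (K : fieldType) (n : nat)
    (p : affine_space K {set 'I_n}) : affine_space K (higher_index n) :=
  [ffun I : higher_index n => cumulant p (val I)].

Definition tangential_cumulant_variety (K : fieldType) (n : nat) :
    affine_space K (higher_index n) -> Prop :=
  zariski_closure (fun k => exists p : affine_space K {set 'I_n},
    [/\ tangential_variety (@segre K n) p,
        moment p set0 = 1
      & k = higher_cumulants p]).

Definition squarefree_toric_variety (K : fieldType) (n : nat) :
    affine_space K (higher_index n) -> Prop :=
  zariski_closure (fun k => exists s : 'I_n -> K,
    k = [ffun I : higher_index n => \prod_(i in val I) s i]).

(* Main.v *)
Require Import Defs.
From HB Require Import structures.
From mathcomp Require Import all_boot all_order all_algebra.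
From mathcomp Require Import reals complex mpoly.
From mathcomp Require Import zify ring.
From Stdlib Require Import Classical.

(** Isomorphism.  The moments of a point on a tangent line of the Segre variety
    have, modulo the squares [x_i^2] and up to a scalar, the generating function
    [\prod_i (1 + u_i x_i) * (1 + \sum_i t_i x_i)].  The logarithm of the first
    factor is linear, so for [|I| >= 2] the cumulant is
    [k_I = (-1)^(|I|-1) (|I|-1)! \prod_(i in I) t_i], and a diagonal rescaling
    identifies the two varieties.  The logarithm is handled through the Euler
    derivations [x_i d/dx_i], which preserve the ideal of the squares.  Points of
    the projective closure are reached by homogenizing polynomials with respect
    to [mu_0].

    Dimension.  The sets [s_j = 1] for [j >= i] give a chain of length [n]; it is
    strict because [y_ij y_ik = s_i^2 y_jk].  Conversely, if [P_i] vanishes on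
    [Z_i] but not on the irreducible [Z_(i+1)], the monomials in the [P_i] are
    linearly independent, so a chain of length [m] yields [D^m] independent
    functions of degree [O(D)]; pulled back to [K^n] they are polynomials in [n]
    variables, of which only [O(D^n)] are independent. *)

Set Implicit Arguments.
Unset Strict Implicit.
Unset Printing Implicit Defensive.

Import Order.TTheory GRing.Theory Num.Theory.
Local Open Scope ring_scope.

(** * Polynomial functions, Zariski closure and restriction to curves *)

Section PolynomialFunctions.
Variables (K : fieldType) (T : finType).
Implicit Types (P Q : {mpoly K[#|T|]}) (v : affine_space K T).

Lemma pevalD P Q v : peval (P + Q) v = peval P v + peval Q v.
Proof. exact: mevalD. Qed.

Lemma pevalM P Q v : peval (P * Q) v = peval P v * peval Q v.
Proof. exact: mevalM. Qed.

Lemma pevalZ c P v : peval (c *: P) v = c * peval P v.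
Proof. exact: mevalZ. Qed.

Lemma pevalC c v : peval c%:MP v = c.
Proof. exact: mevalC. Qed.

Lemma pevalXn P k v : peval (P ^+ k) v = peval P v ^+ k.
Proof. exact: rmorphXn. Qed.

Lemma pevalU t v : peval 'X_(enum_rank t) v = v t.
Proof. by rewrite /peval mevalXU enum_rankK. Qed.

Lemma peval_sum (I : Type) (r : seq I) (A : pred I) (F : I -> {mpoly K[#|T|]}) v :
  peval (\sum_(i <- r | A i) F i) v = \sum_(i <- r | A i) peval (F i) v.
Proof. exact: raddf_sum. Qed.

(** The closure properties of this predicate replace the explicit construction of polynomials, for
    instance for the cumulants. *)
Definition polyfun (f : affine_space K T -> K) : Prop :=
  exists P, forall v, peval P v = f v.

Lemma eq_polyfun f g : f =1 g -> polyfun f -> polyfun g.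
Proof. by move=> fg [P hP]; exists P => v; rewrite hP fg. Qed.

Lemma polyfun_const c : polyfun (fun=> c).
Proof. by exists c%:MP => v; rewrite pevalC. Qed.

Lemma polyfun_coord t : polyfun (fun v => v t).
Proof. by exists 'X_(enum_rank t) => v; rewrite pevalU. Qed.

Lemma polyfunD f g : polyfun f -> polyfun g -> polyfun (fun v => f v + g v).
Proof. by move=> [P hP] [Q hQ]; exists (P + Q) => v; rewrite pevalD hP hQ. Qed.

Lemma polyfunM f g : polyfun f -> polyfun g -> polyfun (fun v => f v * g v).
Proof. by move=> [P hP] [Q hQ]; exists (P * Q) => v; rewrite pevalM hP hQ. Qed.

Lemma polyfun_sum (I : Type) (r : seq I) (A : pred I) F :
  (forall i, polyfun (F i)) -> polyfun (fun v => \sum_(i <- r | A i) F i v).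
Proof.
move=> hF; elim: r => [|i r IHr].
  by apply: eq_polyfun (polyfun_const 0) => v; rewrite big_nil.
case Ai: (A i).
  by apply: eq_polyfun (polyfunD (hF i) IHr) => v; rewrite big_cons Ai.
by apply: eq_polyfun IHr => v; rewrite big_cons Ai.
Qed.

Lemma polyfun_prod (I : Type) (r : seq I) (A : pred I) F :
  (forall i, polyfun (F i)) -> polyfun (fun v => \prod_(i <- r | A i) F i v).
Proof.
move=> hF; elim: r => [|i r IHr].
  by apply: eq_polyfun (polyfun_const 1) => v; rewrite big_nil.
case Ai: (A i).
  by apply: eq_polyfun (polyfunM (hF i) IHr) => v; rewrite big_cons Ai.
by apply: eq_polyfun IHr => v; rewrite big_cons Ai.
Qed.

Lemma polyfunX f k : polyfun f -> polyfun (fun v => f v ^+ k).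
Proof. by move=> [P hP]; exists (P ^+ k) => v; rewrite pevalXn hP. Qed.

Lemma zero_set_closed P : zariski_closed (fun v => peval P v = 0).
Proof. by move=> v; apply. Qed.

Lemma sub_zariski_closure (S : affine_space K T -> Prop) v :
  S v -> zariski_closure S v.
Proof. by move=> Sv P; apply. Qed.

Lemma zariski_closure_closed (S : affine_space K T -> Prop) :
  zariski_closed (zariski_closure S).
Proof. by move=> v hv P PS; apply: hv => w; apply. Qed.

Lemma zariski_closedPn (S : affine_space K T -> Prop) v :
  zariski_closed S -> ~ S v -> exists2 P, vanishes_on P S & peval P v != 0.
Proof.
move=> Scl nSv; apply: NNPP => nP; apply/nSv/Scl => P PS.
by apply/eqP/negP => /negP Pv; apply: nP; exists P.
Qed.

Lemma irreducible_mul_eq0 (Z : affine_space K T -> Prop) P Q :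
  irreducible Z -> vanishes_on (P * Q) Z -> vanishes_on P Z \/ vanishes_on Q Z.
Proof.
move=> [_ irrZ] PQ; apply: irrZ (@zero_set_closed P) (@zero_set_closed Q) _.
move=> v /PQ/eqP; rewrite pevalM mulf_eq0 => /orP[] /eqP; by [left | right].
Qed.

(** The pullback of [P] to the polynomial curve [h]. It lies in a domain, where products and generic
    vanishing are easy to handle. *)
Definition along (h : T -> {poly K}) P : {poly K} :=
  mmap polyC (fun j => h (enum_val j)) P.

Lemma horner_along h P e : (along h P).[e] = peval P [ffun t => (h t).[e]].
Proof.
rewrite /along /peval mevalE /mmap horner_sum; apply: eq_bigr => m _.
rewrite hornerM hornerC /mmap1 horner_prod; congr (_ * _).
by apply: eq_bigr => j _; rewrite horner_exp ffunE.
Qed.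

End PolynomialFunctions.

Lemma polyfun_comp (K : fieldType) (T U : finType) (Q : {mpoly K[#|U|]})
    (f : affine_space K T -> affine_space K U) :
  (forall u, polyfun (fun v => f v u)) -> polyfun (fun v => peval Q (f v)).
Proof.
move=> hf; apply: eq_polyfun (fun v => esym (mevalE _ _)) _.
apply: polyfun_sum => m; apply: polyfunM; first exact: polyfun_const.
by apply: polyfun_prod => j; apply: polyfunX.
Qed.

Lemma poly_fun_eq0 (K : numFieldType) (p : {poly K}) :
  (forall e, p.[e] = 0) -> p = 0.
Proof.
move=> p0; apply/eqP/negP => /negP pn0.
(* In characteristic 0 these are [size p] distinct roots, one more than the degree allows. *)
have /max_poly_roots := pn0; move=> /(_ [seq i%:R | i <- iota 0 (size p)]).
rewrite size_map size_iota ltnn => H; suff: false by []; apply: H.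
  by apply/allP => _ /mapP[i _ ->]; apply/rootP.
by rewrite map_inj_uniq ?iota_uniq // => i j /eqP; rewrite eqr_nat => /eqP.
Qed.

Lemma peval_generic (K : numFieldType) (T : finType) (P : {mpoly K[#|T|]})
    (h : T -> {poly K}) (r : {poly K}) :
  r != 0 ->
  (forall e, r.[e] != 0 -> peval P [ffun t => (h t).[e]] = 0) ->
  forall e, peval P [ffun t => (h t).[e]] = 0.
Proof.
move=> r0 Pr e; rewrite -horner_along.
have : r * along h P = 0.
  apply: poly_fun_eq0 => x; rewrite hornerM horner_along.
  by have [->|/Pr->] := eqVneq r.[x] 0; rewrite ?mul0r ?mulr0.
by move/eqP; rewrite mulf_eq0 (negPf r0) => /eqP ->; rewrite horner0.
Qed.

(** * Upper bound for the dimension, by counting independent functions *)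

Section DimensionUpperBound.
Variable K : fieldType.

Definition independent_on (T : finType) (Z : affine_space K T -> Prop)
    (J : finType) (F : J -> {mpoly K[#|T|]}) : Prop :=
  forall c : J -> K,
    (forall v, Z v -> \sum_j c j * peval (F j) v = 0) -> forall j, c j = 0.

(** In a relation on [Z'], the lowest power of [P] can be cancelled, because [Z'] is irreducible and
    [P] is not zero on it. Restriction to [Z], where [P] vanishes, then isolates the coefficients of
    that power. *)
Lemma independent_step (T : finType) (Z Z' : affine_space K T -> Prop)
    (P : {mpoly K[#|T|]}) (J : finType) (F : J -> {mpoly K[#|T|]}) (D : nat) :
  (forall v, Z v -> Z' v) -> irreducible Z' -> vanishes_on P Z ->
  ~ vanishes_on P Z' -> independent_on Z F ->
  independent_on Z' (fun x : 'I_D * J => P ^+ x.1 * F x.2).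
Proof.
move=> ZZ' irrZ' PZ PZ' indF c c0.
suff H k : forall i : 'I_D, (i < k)%N -> forall j, c (i, j) = 0.
  by case=> i j; apply: (H D).
elim: k => [//|k IHk] i; rewrite ltnS leq_eqVlt => /orP[/eqP ik|]; last exact: IHk.
(* The relation divided by [P ^+ k]; the coefficients with exponent below [k] are already known to
   be zero. *)
pose Q := \sum_(x : 'I_D * J | (k <= x.1)%N) c x *: (P ^+ (x.1 - k) * F x.2).
have PQ : vanishes_on (P ^+ k * Q) Z'.
  move=> v Zv; rewrite pevalM pevalXn peval_sum mulr_sumr -[RHS](c0 v Zv).
  rewrite [RHS](bigID (fun x : 'I_D * J => k <= x.1)%N) /=.
  rewrite [X in _ = _ + X]big1 ?addr0 => [|[x1 x2] /=]; last first.
    by rewrite -ltnNge => /IHk ->; rewrite mul0r.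
  apply: eq_bigr => x kx; rewrite pevalZ !pevalM !pevalXn.
  have -> : peval P v ^+ x.1 = peval P v ^+ k * peval P v ^+ (x.1 - k).
    by rewrite -exprD subnKC.
  by ring.
case: (irreducible_mul_eq0 irrZ' PQ) => [Pk|Q0].
  case: PZ' => v /Pk; rewrite pevalXn => /eqP.
  by rewrite expf_eq0 => /andP[_ /eqP].
apply: indF => v Zv; rewrite -[RHS](Q0 v (ZZ' _ Zv)) peval_sum.
rewrite (bigID (fun x : 'I_D * J => x.1 == i)) /= [X in _ = _ + X]big1 ?addr0; last first.
  move=> [x1 x2] /= /andP[kx xi]; rewrite pevalZ pevalM pevalXn PZ // expr0n.
  rewrite subn_eq0 leqNgt ltn_neqAle kx -ik eq_sym (inj_eq val_inj) xi.
  by rewrite mul0r mulr0.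
rewrite (reindex_onto (pair i) snd) /= => [|[x1 x2] /= /andP[_ /eqP->] //].
apply: eq_big => [j|j _]; first by rewrite ik leqnn !eqxx.
by rewrite pevalZ pevalM ik subnn expr0 /peval meval1 mul1r.
Qed.

Lemma card_bmultinom_le n d : (#|{: 'X_{1..n < d}}| <= d ^ n)%N.
Proof.
have lt_d (m : 'X_{1..n < d}) i : (m i < d)%N.
  by apply: leq_ltn_trans (bmdeg m); rewrite mdegE (bigD1 i) //= leq_addr.
pose f (m : 'X_{1..n < d}) := [ffun i : 'I_n => Ordinal (lt_d m i)].
have f_inj : injective f.
  move=> m1 m2 /ffunP fE; apply/val_inj/mnmP => i.
  by have /(congr1 val) := fE i; rewrite !ffunE.
by have := leq_card f f_inj; rewrite card_ffun !card_ord.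
Qed.

(** The coefficient vectors are independent rows of a matrix whose columns are the monomials of
    degree less than [d]. *)
Lemma free_mpoly_card_le n d (J : finType) (F : J -> {mpoly K[n]}) :
  (forall j, (msize (F j) <= d)%N) ->
  (forall c : J -> K, \sum_j c j *: F j = 0 -> forall j, c j = 0) ->
  (#|J| <= d ^ n)%N.
Proof.
move=> Fd freeF; apply: leq_trans (card_bmultinom_le n d).
pose M : 'M[K]_(#|J|, #|{: 'X_{1..n < d}}|) :=
  \matrix_(i, k) (F (enum_val i))@_(enum_val k : 'X_{1..n < d}).
suff /eqP <- : row_free M by exact: rank_leq_col.
apply: inj_row_free => u uM0; apply/rowP => i; rewrite mxE.
rewrite -(enum_valK i); apply: (freeF (fun j => u 0 (enum_rank j))).
apply/mpolyP => m; rewrite raddf_sum /= mcoeff0.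
have [md|md] := ltnP (mdeg m) d; last first.
  rewrite big1 // => j _; rewrite mcoeffZ memN_msupp_eq0 ?mulr0 //.
  by apply/msize_mdeg_ge/(leq_trans (Fd j)).
have /matrixP/(_ 0 (enum_rank (BMultinom md))) := uM0; rewrite !mxE => uMm.
rewrite -[RHS]uMm.
rewrite (reindex_onto (@enum_val _ J) enum_rank) /= => [|j _]; last exact: enum_rankK.
apply: eq_big => [j|j _]; first by rewrite enum_valK eqxx.
by rewrite mcoeffZ mxE enum_valK enum_rankK.
Qed.

Lemma msize_comp_monomials (N n : nat) (a : 'I_N -> 'X_{1..n})
    (P : {mpoly K[N]}) (b e : nat) :
  (forall j, mdeg (a j) <= b)%N -> (msize P <= e)%N ->
  (msize (P \mPo [tuple 'X_[K, a j] | j < N]) <= (b * e).+1)%N.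
Proof.
move=> ab Pe; rewrite comp_mpolyEX; apply: (leq_trans (mmeasure_sum _ _ _ _)).
apply/bigmax_leqP_seq => m mP _.
apply: leq_trans (msizeZ_le _ _) _; rewrite comp_mpolyX.
under eq_bigr do rewrite tnth_mktuple mpolyXn.
rewrite mprodXE msizeX ltnS mdeg_sum.
apply: (@leq_trans (b * mdeg m)); last first.
  by rewrite leq_mul2l (ltnW (leq_trans (msize_mdeg_lt mP) Pe)) orbT.
by rewrite mdegE big_distrr leq_sum //= => j _; rewrite mdegMn leq_mul2r ab orbT.
Qed.


Lemma msizeM_leq n (P Q : {mpoly K[n]}) a b :
  (msize P <= a.+1)%N -> (msize Q <= b.+1)%N -> (msize (P * Q) <= (a + b).+1)%N.
Proof.
have [->|P0] := eqVneq P 0; first by rewrite mul0r msize0.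
have [->|Q0] := eqVneq Q 0; first by rewrite mulr0 msize0.
rewrite msizeM //; set x := mmeasure _ P; set y := mmeasure _ Q.
by move: x y => x y; lia.
Qed.

Lemma msizeXn_leq n (P : {mpoly K[n]}) a k :
  (msize P <= a.+1)%N -> (msize (P ^+ k) <= (k * a).+1)%N.
Proof.
move=> Pa; elim: k => [|k IHk]; first by rewrite expr0 msize1.
by rewrite exprS mulSn; apply: msizeM_leq.
Qed.

(** Each step of the chain supplies a new [P], whose powers below [D] multiply the number of
    functions by [D] and raise the degree by at most [D * msize P]. It is essential that [E] does
    not depend on [D]. *)
Lemma chain_independent (T : finType) (X : affine_space K T -> Prop) m Z :
  irreducible_chain X m Z ->
  forall i, (i <= m)%N -> exists E, forall D, (0 < D)%N ->
    exists (J : finType) (F : J -> {mpoly K[#|T|]}),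
      [/\ #|J| = (D ^ i)%N, forall j, (msize (F j) <= (D * E).+1)%N
        & independent_on (Z i) F].
Proof.
move=> [Zcl Zlt]; elim=> [|i IHi] im.
  (* The constant 1 is independent on [Z 0] because [Z 0] is nonempty. *)
  exists 0%N => D _; exists unit, (fun=> 1); split; first by rewrite card_unit.
    by move=> _; rewrite msize1.
  have [_ [[v Zv] _] _] := Zcl 0%N im.
  move=> c /(_ v Zv); rewrite (big_pred1 tt); last by case.
  by rewrite /peval meval1 mulr1 => c0 [].
have [E hE] := IHi (ltnW im).
have [Zi_cl _ _] := Zcl i (ltnW im).
have [_ Zi1_irr _] := Zcl _ im.
have [sub [v [Zv nZv]]] := Zlt i im.
have [P PZ Pv] := zariski_closedPn Zi_cl nZv.
exists (E + msize P)%N => D D0; have [J [F [cJ sF indF]]] := hE D D0.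
exists ('I_D * J)%type, (fun x : 'I_D * J => P ^+ x.1 * F x.2); split.
- by rewrite card_prod card_ord cJ expnS.
- move=> [k j] /=; rewrite mulnDr addnC; apply: msizeM_leq (sF j).
  apply: leq_trans (msizeXn_leq k (leqnSn _)) _.
  by rewrite ltnS leq_mul2r (ltnW (ltn_ord k)) orbT.
- apply: independent_step sub Zi1_irr PZ _ indF => /(_ v Zv) P0.
  by rewrite P0 eqxx in Pv.
Qed.

Lemma monomial_chain_le (T : finType) (n : nat) (a : T -> 'X_{1..n})
    (m : nat) (Z : nat -> affine_space K T -> Prop) :
  irreducible_chain (zariski_closure (fun v => exists s : 'I_n -> K,
    v = [ffun t => \prod_i s i ^+ a t i])) m Z -> (m <= n)%N.
Proof.
move=> chZ; have [E hE] := chain_independent chZ (leqnn m).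
rewrite leqNgt; apply/negP => nm.
(* The pullbacks have size at most [(b * (D * E).+1).+1], which is at most [C * D] as soon as [D] is
   positive. *)
pose b := (\max_t mdeg (a t))%N; pose C := (b * E + b).+1.
have bound D : (0 < D)%N -> (D ^ m <= (C * D) ^ n)%N.
  move=> D0; have [J [F [<- sF indF]]] := hE D D0.
  pose aux (j : 'I_#|T|) := a (enum_val j).
  pose G j := F j \mPo [tuple 'X_[K, aux k] | k < #|T|].
  apply: leq_trans (@free_mpoly_card_le _ (b * (D * E).+1).+1 _ G _ _) _.
  - by move=> j; apply: msize_comp_monomials => // k; apply: leq_bigmax.
  (* A relation between the pullbacks holds on the parametrized set, hence on its closure, which
     contains [Z m]. *)
  - move=> c c0; apply: indF => v Zv; have [_ _ ZX] := chZ.1 m (leqnn m).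
    have -> : \sum_j c j * peval (F j) v = peval (\sum_j c j *: F j) v.
      by rewrite peval_sum; apply: eq_bigr => j _; rewrite pevalZ.
    apply: (ZX v Zv) => _ [s ->]; have := congr1 (meval s) c0.
    rewrite meval0 raddf_sum peval_sum => cs; rewrite -[RHS]cs.
    apply: eq_bigr => j _; rewrite pevalZ /= mevalZ comp_mpoly_meval.
    by congr (_ * _); apply: meval_eq => k; rewrite tnth_mktuple mevalX ffunE.
  - by case: (n) => [|k]; rewrite ?expn0 // leq_exp2r // /C; nia.
(* For [D = C ^ n + 1] one has [(C * D) ^ n < D ^ n.+1 <= D ^ m]. *)
have := bound (C ^ n).+1 isT; rewrite expnMn leqNgt => /negP; apply.
apply: leq_trans (leq_pexp2l _ nm); last by [].
by rewrite expnS ltn_mul2r expn_gt0 ltnS leqnn.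
Qed.

End DimensionUpperBound.

(** * The toric variety and its dimension *)

Section ToricVariety.
Variables (K : numFieldType) (n : nat).
Implicit Types (s : 'I_n -> K) (W : ('I_n -> K) -> Prop).

Definition toric_map s : affine_space K (higher_index n) :=
  [ffun I : higher_index n => \prod_(i in val I) s i].

Definition toric_closure W : affine_space K (higher_index n) -> Prop :=
  zariski_closure (fun v => exists2 s, W s & v = toric_map s).

(** If neither [A] nor [B] suffices, some [P] vanishing on [A] and some [Q] vanishing on [B] are
    nonzero at the images of two parameters [s] and [s']. The line through them stays in [W], so the
    product of the pullbacks to it is zero; one factor is then zero, against its value at [e = 0] or
    [e = 1]. *)
Lemma toric_closure_irreducible W :
  (exists s, W s) ->
  (forall s s' e, W s -> W s' -> W (fun j => s j + e * (s' j - s j))) ->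
  irreducible (toric_closure W).
Proof.
move=> [s0 Ws0] Wline; split.
  by exists (toric_map s0); apply: sub_zariski_closure; exists s0.
have separate A : zariski_closed A -> ~ (forall v, toric_closure W v -> A v) ->
    exists2 P, vanishes_on P A & exists2 s, W s & peval P (toric_map s) != 0.
  move=> Acl nA; apply: NNPP => nP; apply: nA => v Wv; apply: Acl => P PA.
  apply: Wv => _ [s Ws ->]; apply/eqP/negP => /negP Ps.
  by apply: nP; exists P => //; exists s.
move=> A B Acl Bcl AB; apply: NNPP => /not_or_and[/(separate A Acl) hA /(separate B Bcl)].
move: hA => [P PA [s Ws Ps]] [Q QB [s' Ws' Qs']].
pose h (I : higher_index n) := \prod_(i in val I) ((s i)%:P + (s' i - s i) *: 'X).
have hE e : [ffun I => (h I).[e]] = toric_map (fun j => s j + e * (s' j - s j)).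
  apply/ffunP => I; rewrite !ffunE horner_prod; apply: eq_bigr => i _.
  by rewrite !hornerE mulrC.
have : along h P * along h Q = 0.
  apply: poly_fun_eq0 => e; rewrite hornerM !horner_along hE.
  have We := Wline s s' e Ws Ws'.
  case: (AB (toric_map (fun j => s j + e * (s' j - s j)))).
  - by apply: sub_zariski_closure; exists (fun j => s j + e * (s' j - s j)).
  - by move/PA => ->; rewrite mul0r.
  - by move/QB => ->; rewrite mulr0.
move/eqP; rewrite mulf_eq0 => /orP[] /eqP h0.
- have := horner_along h P 0; rewrite h0 horner0 hE => /esym P0.
  case/negP: Ps; apply/eqP; rewrite -[RHS]P0; congr peval; apply/ffunP => I.
  by rewrite !ffunE; apply: eq_bigr => i _; rewrite mul0r addr0.
- have := horner_along h Q 1; rewrite h0 horner0 hE => /esym Q0.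
  case/negP: Qs'; apply/eqP; rewrite -[RHS]Q0; congr peval; apply/ffunP => I.
  by rewrite !ffunE; apply: eq_bigr => i _; rewrite mul1r subrKC.
Qed.

Lemma toric_quadric i j k : i != j -> i != k -> j != k ->
  exists P : {mpoly K[#|higher_index n|]},
    forall s, peval P (toric_map s) = (s i ^+ 2 - 1) * (s j * s k).
Proof.
have pair_card (x y : 'I_n) : x != y -> (1 < #|[set x; y]|)%N.
  by move=> xy; rewrite cards2 xy.
move=> ij ik jk.
pose c x y (xy : x != y) : higher_index n := exist _ [set x; y] (pair_card x y xy).
have cE x y (xy : x != y) s : toric_map s (c x y xy) = s x * s y.
  by rewrite ffunE /= big_setU1 ?inE //= big_set1.
exists ('X_(enum_rank (c i j ij)) * 'X_(enum_rank (c i k ik))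
        + (-1) *: 'X_(enum_rank (c j k jk))) => s.
by rewrite pevalD pevalM pevalZ !pevalU !cE; ring.
Qed.

Lemma two_other_ord (i : 'I_n) : (2 < n)%N ->
  exists j k : 'I_n, [/\ i != j, i != k & j != k].
Proof.
move=> n2; have n1 : (1 < n)%N by apply: ltnW.
have n0 : (0 < n)%N by apply: ltnW.
case: i => [[|[|i]] ilt].
- by exists (Ordinal n1), (Ordinal n2).
- by exists (Ordinal n0), (Ordinal n2).
- by exists (Ordinal n0), (Ordinal n1).
Qed.

Lemma squarefree_toric_dimension :
  (2 < n)%N -> has_dimension (@squarefree_toric_variety K n) n.
Proof.
move=> n2; split; last first.
  pose a (I : higher_index n) : 'X_{1..n} := [multinom nat_of_bool (i \in val I) | i < n].
  have aE s (I : higher_index n) : \prod_i s i ^+ a I i = \prod_(i in val I) s i.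
    rewrite [RHS]big_mkcond; apply: eq_bigr => i _.
    by rewrite mnmE; case: ifP; rewrite ?expr1.
  move=> m Z [ch1 ch2]; apply: (@monomial_chain_le _ _ n a m Z); split => // i im.
  have [Zcl Zirr ZX] := ch1 i im; split => // v /ZX Xv P PS; apply: Xv => w [s ->].
  by apply: PS; exists s; apply/ffunP => I; rewrite !ffunE aE.
pose W (i : nat) s := forall j : 'I_n, (i <= j)%N -> s j = 1.
exists (fun i => toric_closure (W i)); split=> [i _|i ilt].
  split; first exact: zariski_closure_closed.
    apply: toric_closure_irreducible; first by exists (fun=> 1).
    by move=> s s' e Ws Ws' j ij; rewrite Ws // Ws' // subrr mulr0 addr0.
  move=> v Wv P PS; apply: Wv => _ [s _ ->].
  by apply: PS; exists s.
split=> [v Wv P PS|].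
  apply: Wv => _ [s Ws ->]; apply: PS; exists s => // j ij.
  by apply: Ws; apply: ltnW.
pose o := Ordinal ilt; have [j [k [oj ok jk]]] := two_other_ord o n2.
(* [P] vanishes on the [i]-th closure, where the parameter at [o] is 1. Setting that parameter to 2
   gives a point of the next closure where [P] is 3. *)
have [P PE] := toric_quadric oj ok jk.
pose s x : K := if x == o then 2 else 1.
exists (toric_map s); split.
  apply: sub_zariski_closure; exists s => // x ix; rewrite /s ifN //.
  by apply: contraTneq ix => ->; rewrite ltnn.
move=> /(_ P) H; have /eqP : peval P (toric_map s) = 0.
  by apply: H => _ [t Wt ->]; rewrite PE (Wt o) // expr1n subrr mul0r.
rewrite PE /s eqxx (negPf (_ : j != o)) 1?eq_sym // (negPf (_ : k != o)) 1?eq_sym //.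
have -> : (2 ^+ 2 - 1) * (1 * 1) = 3%:R :> K by ring.
by rewrite pnatr_eq0.
Qed.

End ToricVariety.

(** * The logarithm modulo the squares of the variables *)

Section TruncatedLogarithm.
Variables (K : numFieldType) (n : nat).
Implicit Types (p q f g : {mpoly K[n]}) (I : {set 'I_n}) (m : 'X_{1..n}).

Definition sqfree I : 'X_{1..n} := [multinom nat_of_bool (i \in I) | i < n].

Lemma sqfree0 : sqfree set0 = 0%MM.
Proof. by apply/mnmP => i; rewrite !mnmE inE. Qed.

Lemma mdeg_sqfree I : mdeg (sqfree I) = #|I|.
Proof.
rewrite mdegE -sum1_card [RHS]big_mkcond; apply: eq_bigr => i _.
by rewrite mnmE; case: (i \in I).
Qed.

Lemma sqfreeD1 I i : i \in I -> sqfree I = (U_(i) + sqfree (I :\ i))%MM.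
Proof.
move=> iI; apply/mnmP => j; rewrite !mnmE !inE eq_sym.
by case: eqVneq => [->|]; rewrite ?iI //=; case: (j \in I).
Qed.

(* No square-free monomial occurs in p, i.e. p lies in <x_1^2, ..., x_n^2>. *)
Definition sqnull p : Prop := forall I, p@_(sqfree I) = 0.

Lemma sqnullD p q : sqnull p -> sqnull q -> sqnull (p + q).
Proof. by move=> hp hq I; rewrite mcoeffD hp hq addr0. Qed.

Lemma sqnullN p : sqnull p -> sqnull (- p).
Proof. by move=> hp I; rewrite mcoeffN hp oppr0. Qed.

Lemma sqnullB p q : sqnull p -> sqnull q -> sqnull (p - q).
Proof. by move=> hp hq; apply/sqnullD/sqnullN. Qed.

(** The ideal property: every divisor of a square-free monomial is square-free. *)
Lemma sqnullM p q : sqnull p -> sqnull (p * q).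
Proof.
move=> hp I; rewrite mcoeffM big1 // => k /eqP Ik.
suff -> : (k.1 : 'X_{1..n}) = sqfree [set i | k.1 i != 0%N] by rewrite hp mul0r.
apply/mnmP => i; have := congr1 (fun m : 'X_{1..n} => m i) Ik.
rewrite mnmDE !mnmE inE; case: (i \in I) => /=; lia.
Qed.

Lemma sqnull_sum (J : Type) (r : seq J) (A : pred J) F :
  (forall j, sqnull (F j)) -> sqnull (\sum_(j <- r | A j) F j).
Proof. by move=> hF I; rewrite raddf_sum big1 // => j _; apply: hF. Qed.

Lemma sqnull_sqr i : sqnull ('X_i ^+ 2).
Proof.
move=> I; rewrite mcoeffXn; case: eqP => // /mnmP/(_ i).
by rewrite mulmnE !mnmE eqxx; case: (i \in I).
Qed.

(** Membership in the [k]-th power of the ideal of the origin. *)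
Definition order_ge (k : nat) p : Prop := forall m, (mdeg m < k)%N -> p@_m = 0.

Lemma order_geM a b p q : order_ge a p -> order_ge b q -> order_ge (a + b) (p * q).
Proof.
move=> hp hq m mab; rewrite mcoeffM big1 // => k /eqP/(congr1 (@mdeg n)).
rewrite mdegD => mk; have [ka|ka] := ltnP (mdeg k.1) a; first by rewrite hp ?mul0r.
rewrite mk in mab; rewrite hq ?mulr0 // -(ltn_add2l a).
by apply: leq_ltn_trans mab; rewrite leq_add2r.
Qed.

Lemma order_geXn k p : p@_0%MM = 0 -> order_ge k (p ^+ k).
Proof.
move=> p0; elim: k => [m //|k IHk]; rewrite exprS -add1n; apply: order_geM IHk.
by move=> m; rewrite ltnS leqn0 mdeg_eq0 => /eqP ->.
Qed.

Lemma order_ge_sqnull k p : (n < k)%N -> order_ge k p -> sqnull p.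
Proof.
move=> nk hp I; apply: hp; rewrite mdeg_sqfree.
by apply: leq_ltn_trans nk; rewrite -[leqRHS]card_ord max_card.
Qed.

(** The Euler derivation is diagonal on monomials, with the exponent of [x_i] as eigenvalue;
    square-free monomials divisible by [x_i] are fixed. *)
Definition theta i p : {mpoly K[n]} := 'X_i * p^`M(i).

Lemma mcoeff_theta i p m : (theta i p)@_m = p@_m *+ m i.
Proof.
rewrite /theta [X in X^`M(i)]mpolyE [in RHS](mpolyE p) !raddf_sum /= mulr_sumr raddf_sum.
rewrite -sumrMnl; apply: eq_bigr => k _.
rewrite /= mderivZ mderivX -!scalerAr -mpolyXD scalerA !mcoeffZ !mcoeffX.
case: (posnP (k i)) => [ki|ki].
  rewrite ki mulr0 mul0r; case: eqP => [<-|]; by rewrite ?ki ?mulr0n ?mulr0 ?mul0rn.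
have -> : (U_(i) + (k - U_(i)))%MM = k.
  apply/mnmP => j; rewrite mnmDE mnmBE mnm1E.
  by case: eqP => [<-|_] /=; rewrite ?subnKC // add0n subn0.
case: eqP => [->|_]; last by rewrite !mulr0 mul0rn.
by rewrite !mulr1 mulr_natr.
Qed.

Lemma mcoeff_theta_sqfree i p I : i \in I -> (theta i p)@_(sqfree I) = p@_(sqfree I).
Proof. by move=> iI; rewrite mcoeff_theta mnmE iI. Qed.

Lemma sqnull_theta i p : sqnull p -> sqnull (theta i p).
Proof. by move=> hp I; rewrite mcoeff_theta hp mul0rn. Qed.

Lemma thetaD i p q : theta i (p + q) = theta i p + theta i q.
Proof. by rewrite /theta mderivD mulrDr. Qed.

Lemma thetaB i p q : theta i (p - q) = theta i p - theta i q.
Proof. by rewrite /theta mderivB mulrBr. Qed.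

Lemma thetaM i p q : theta i (p * q) = theta i p * q + p * theta i q.
Proof. by rewrite /theta mderivM; ring. Qed.

Lemma thetaZ i c p : theta i (c *: p) = c *: theta i p.
Proof. by rewrite /theta mderivZ scalerAr. Qed.

Lemma theta_sum (J : Type) (r : seq J) (A : pred J) F i :
  theta i (\sum_(j <- r | A j) F j) = \sum_(j <- r | A j) theta i (F j).
Proof. by rewrite /theta (raddf_sum (mderiv i)) mulr_sumr. Qed.

Lemma theta1 i : theta i 1 = 0.
Proof. by rewrite /theta -mpolyC1 mderivC mulr0. Qed.

Lemma thetaXn i p k : theta i (p ^+ k.+1) = (theta i p * p ^+ k) *+ k.+1.
Proof.
elim: k => [|k IHk]; first by rewrite expr1 expr0 mulr1.
by rewrite [p ^+ k.+2]exprS thetaM IHk [RHS]mulrS mulrnAr mulrCA -exprS.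
Qed.

Lemma thetaU i j : theta i 'X_j = if i == j then 'X_j else 0.
Proof.
apply/mpolyP => m; rewrite mcoeff_theta mcoeffX.
case: eqP => [<-|jm]; last first.
  by rewrite mul0rn; case: eqP => _; rewrite ?mcoeff0 ?mcoeffX //; case: eqP.
rewrite mnm1E eq_sym; case: eqP => _; rewrite ?mcoeff0 ?mulr0n //.
by rewrite mcoeffX eqxx.
Qed.

(* Euler derivations turn log into a logarithmic derivative. *)
Lemma theta_trunc_log i f : f@_0%MM = 1 ->
  sqnull (theta i (Defs.trunc_log f) * f - theta i f).
Proof.
move=> f0; set g := f - 1.
have g0 : g@_0%MM = 0 by rewrite mcoeffB f0 mcoeff1 eqxx subrr.
have thg : theta i f = theta i g by rewrite thetaB theta1 subr0.
(* Differentiating the Mercator series gives the truncated geometric series of [1 / (1 + g)]. *)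
have -> : theta i (Defs.trunc_log f) = theta i g * \sum_(k < n) (- g) ^+ k.
  rewrite /Defs.trunc_log -/g big_add1 /= big_mkord theta_sum mulr_sumr.
  apply: eq_bigr => k _; rewrite thetaZ thetaXn.
  rewrite -scaler_nat scalerA divfK ?pnatr_eq0 //.
  by rewrite -mul_mpolyC rmorphXn /= mpolyCN mpolyC1 [in RHS]exprNn mulrCA.
have -> : theta i g * (\sum_(k < n) (- g) ^+ k) * f - theta i f
        = - (theta i g * (- g) ^+ n).
  rewrite thg {1}(_ : f = - ((- g) - 1)); last by rewrite /g; ring.
  by rewrite mulrN -mulrA [_ * (- g - 1)]mulrC -subrX1; ring.
(* The remainder has order at least [n + 1]: one from [theta i g] and [n] from the power of [g]. *)
apply: sqnullN; apply: (@order_ge_sqnull n.+1) => //; rewrite -add1n.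
apply: order_geM; last by apply: order_geXn; rewrite mcoeffN g0 oppr0.
by move=> m; rewrite ltnS leqn0 mdeg_eq0 => /eqP ->; rewrite mcoeff_theta mnm0E.
Qed.

(** Modulo the squares [f] is invertible, its inverse being a finite geometric sum in [1 - f]. *)
Lemma sqnull_cancel p f : f@_0%MM = 1 -> sqnull (p * f) -> sqnull p.
Proof.
move=> f0 pf; set g := f - 1.
have g0 : (- g)@_0%MM = 0 by rewrite mcoeffN mcoeffB f0 mcoeff1 eqxx subrr oppr0.
have -> : p = p * f * (\sum_(k < n.+1) (- g) ^+ k) + (- g) ^+ n.+1 * p.
  have := subrX1 (- g) n.+1; move: (\sum_(k < n.+1) _) => S /eqP.
  by rewrite subr_eq => /eqP ->; rewrite /g; ring.
apply: sqnullD; first exact: sqnullM.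
by apply/sqnullM/order_ge_sqnull/order_geXn.
Qed.

(** The hypothesis on [q] says that its logarithm is [\sum_i u_i x_i] up to a constant. Comparing
    logarithmic derivatives of [f] and [q * t] leaves the discrepancy [u_i x_i], which does not
    reach degree 2; for [i \in I] the derivation fixes the coefficient at [I]. *)
Lemma trunc_log_shift (f q t : {mpoly K[n]}) (u : 'I_n -> K) :
  f@_0%MM = 1 -> t@_0%MM = 1 ->
  (forall i, sqnull (theta i q - u i *: 'X_i * q)) ->
  sqnull (f - q * t) ->
  forall I, (1 < #|I|)%N ->
    (Defs.trunc_log f)@_(sqfree I) = (Defs.trunc_log t)@_(sqfree I).
Proof.
move=> f0 t0 hq hf I I1.
have /card_gt0P[i iI] : (0 < #|I|)%N by apply: ltnW.
have := theta_trunc_log i f0; have := theta_trunc_log i t0.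
move: (Defs.trunc_log f) (Defs.trunc_log t) => Lf Lt hLt hLf.
pose d := theta i Lf - (u i *: 'X_i + theta i Lt).
have : sqnull d.
  apply: (sqnull_cancel f0).
  (* After multiplication by [f], the difference is a combination of five members of the ideal. *)
  set nu := f - q * t in hf.
  have -> : d * f = (theta i Lf * f - theta i f) + theta i nu
     + (theta i q - u i *: 'X_i * q) * t
     - (theta i Lt * t - theta i t) * q
     - nu * (u i *: 'X_i + theta i Lt).
    rewrite /nu /d thetaB thetaM; move: (theta i Lf) (theta i Lt) => A B.
    by move: (theta i f) (theta i q) (theta i t) (u i *: 'X_i) => f' q' t' x; ring.
  apply: sqnullB; last exact: sqnullM.
  apply: sqnullB; last exact: sqnullM.
  apply: sqnullD; last exact: sqnullM.
  by apply: sqnullD; last apply: sqnull_theta.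
move=> /(_ I); rewrite mcoeffB mcoeffD mcoeffZ mcoeffX.
rewrite (mcoeff_theta_sqfree Lf iI) (mcoeff_theta_sqfree Lt iI).
case: eqP => [/(congr1 (@mdeg n))|_].
  by rewrite mdeg1 mdeg_sqfree => E; rewrite -E in I1.
by rewrite mulr0 add0r => /eqP; rewrite subr_eq0 => /eqP.
Qed.

Definition lin_form (t : 'I_n -> K) : {mpoly K[n]} := \sum_i t i *: 'X_i.

Lemma lin_form0 t : (lin_form t)@_0%MM = 0.
Proof.
rewrite raddf_sum big1 // => i _; rewrite /= mcoeffZ mcoeffX.
by rewrite mnm1_eq0 mulr0.
Qed.

Lemma theta_lin_form i t : theta i (lin_form t) = t i *: 'X_i.
Proof.
rewrite theta_sum (bigD1 i) //= big1 ?addr0 => [|j ji].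
  by rewrite thetaZ thetaU eqxx.
by rewrite thetaZ thetaU eq_sym (negPf ji) scaler0.
Qed.

(** The factorial counts the orderings of [I]. For the induction, apply [theta i] with [i \in I] and
    cancel [x_i]. *)
Lemma lin_formXn_coef t k I : (lin_form t ^+ k)@_(sqfree I)
  = if k == #|I| then (k`!)%:R * \prod_(i in I) t i else 0.
Proof.
elim: k I => [|k IHk] I.
  rewrite expr0 mcoeff1 -mdeg_eq0 mdeg_sqfree eq_sym.
  case: eqP => [/esym/eqP|//]; rewrite cards_eq0 => /eqP ->.
  by rewrite big_set0 mulr1.
have [->|[i iI]] := set_0Vmem I.
  by rewrite cards0 (order_geXn (k := k.+1)) ?lin_form0 // mdeg_sqfree cards0.
rewrite -(mcoeff_theta_sqfree _ iI) thetaXn theta_lin_form mcoeffMn.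
rewrite -scalerAl mcoeffZ ['X_i * _]mulrC (sqfreeD1 iI) mcoeffMX IHk.
rewrite (cardsD1 i I) iI add1n eqSS; case: eqP => _; last by rewrite mulr0 mul0rn.
rewrite (big_setD1 i iI) /= factS natrM -mulr_natl.
by move: (\prod_(_ in _) _) => x; ring.
Qed.

(* This is (-1)^(#|I| - 1) * (#|I| - 1)!, for nonempty I. *)
Definition cumulant_factor I : K :=
  (-1) ^+ #|I|.-1 / #|I|%:R * (#|I|`!)%:R.

Lemma cumulant_factor_neq0 I : (0 < #|I|)%N -> cumulant_factor I != 0.
Proof.
move=> I0; rewrite !mulf_neq0 ?signr_eq0 ?invr_eq0 ?pnatr_eq0 -?lt0n ?fact_gt0 //.
Qed.

(** By homogeneity only the term of degree [#|I|] of the Mercator series contributes. *)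
Lemma trunc_log_lin_form t I : (0 < #|I|)%N ->
  (Defs.trunc_log (1 + lin_form t))@_(sqfree I) = cumulant_factor I * \prod_(i in I) t i.
Proof.
move=> I0; rewrite /Defs.trunc_log addrAC subrr add0r raddf_sum /=.
have In : (#|I| < n.+1)%N by rewrite ltnS -[leqRHS]card_ord max_card.
rewrite (bigD1_seq #|I|) ?iota_uniq ?mem_index_iota ?I0 //= big1 => [|k kI].
  by rewrite addr0 mcoeffZ lin_formXn_coef eqxx mulrA.
by rewrite mcoeffZ lin_formXn_coef (negPf kI) mulr0.
Qed.

End TruncatedLogarithm.

(** * Homogenization with respect to a linear form *)

Section Homogenization.
Variables (K : fieldType) (T : finType).
Implicit Types (F G : {mpoly K[#|T|]}) (v w : affine_space K T).

Lemma peval_homog d F c v : F \is d.-homog ->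
  peval F [ffun t => c * v t] = c ^+ d * peval F v.
Proof.
move=> /dhomogP Fd; rewrite /peval !mevalE mulr_sumr big_seq [RHS]big_seq.
apply: eq_bigr => m /Fd md; rewrite mulrCA; congr (_ * _).
have <- : mdeg m = d := md; rewrite mdegE -prodrXr -big_split /=.
by apply: eq_bigr => i _; rewrite ffunE exprMn.
Qed.

(* The extra factor of L makes the homogenization vanish on L = 0. *)
Lemma homogenize L G : L \is 1.-homog ->
  exists d F, [/\ F \is d.-homog,
    forall v, peval L v = 0 -> peval F v = 0 &
    forall v, peval L v != 0 ->
      peval F v = peval L v ^+ d * peval G [ffun t => (peval L v)^-1 * v t]].
Proof.
(* The size is the degree plus one, so every homogeneous part of [G] gets at least one factor
   [L]. *)
move=> L1; pose k := msize G.
pose F := \sum_(d < k) pihomog mdeg d G * L ^+ (k - d).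
exists k, F; split.
- apply: rpred_sum => -[d dk] _ /=.
  have := dhomogM (pihomogP mdeg d G) (dhomogMn (k - d) L1).
  by rewrite mul1n subnKC // ltnW.
- move=> v L0; rewrite peval_sum big1 // => d _.
  by rewrite pevalM pevalXn L0 expr0n subn_eq0 leqNgt ltn_ord mulr0.
- move=> v Lv; rewrite {1}(pihomog_partitionE (k := k) (mf := mdeg) (p := G)) //.
  rewrite !peval_sum mulr_sumr; apply: eq_bigr => -[d dk] _ /=.
  rewrite (peval_homog _ _ (pihomogP _ _ _)) pevalM pevalXn mulrA mulrC.
  congr (_ * _); rewrite exprVn -{2}(subnK (ltnW dk)) exprD.
  by rewrite mulfK // expf_neq0.
Qed.

End Homogenization.

(** * Differentials of polynomials and lines as tangents *)

Section Derivatives.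
Variables (K : numFieldType) (T : finType).
Implicit Types (F G : {mpoly K[#|T|]}) (x w : affine_space K T).

(** The differential of [F] at [x] in direction [w], in the exact form used by
    [embedded_tangent_space]. *)
Definition dpeval F x w : K := \sum_(j < #|T|) peval F^`M(j) x * w (enum_val j).

Lemma dpevalD F G x w : dpeval (F + G) x w = dpeval F x w + dpeval G x w.
Proof.
rewrite /dpeval -big_split; apply: eq_bigr => j _ /=.
by rewrite mderivD pevalD mulrDl.
Qed.

Lemma dpevalZ c F x w : dpeval (c *: F) x w = c * dpeval F x w.
Proof.
rewrite /dpeval mulr_sumr; apply: eq_bigr => j _.
by rewrite mderivZ pevalZ mulrA.
Qed.

Lemma dpevalM F G x w :
  dpeval (F * G) x w = dpeval F x w * peval G x + peval F x * dpeval G x w.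
Proof.
rewrite /dpeval mulr_suml mulr_sumr -big_split; apply: eq_bigr => j _ /=.
by rewrite mderivM pevalD !pevalM; ring.
Qed.

Lemma dpeval1 x w : dpeval 1 x w = 0.
Proof.
rewrite /dpeval big1 // => j _.
by rewrite -mpolyC1 mderivC /peval meval0 mul0r.
Qed.

Lemma dpevalX j x w : dpeval 'X_j x w = w (enum_val j).
Proof.
rewrite /dpeval (bigD1 j) //= big1 ?addr0 => [|k kj].
  rewrite mderivX mnm1E eqxx scale1r (_ : (U_(j) - U_(j))%MM = 0%MM).
    by rewrite mpolyX0 /peval meval1 mul1r.
  by apply/mnmP => l; rewrite mnmBE mnm0E subnn.
by rewrite mderivX mnm1E eq_sym (negPf kj) scale0r /peval meval0 mul0r.
Qed.

Lemma dpeval_sum (J : finType) F x (w : J -> affine_space K T) :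
  dpeval F x [ffun t => \sum_j w j t] = \sum_j dpeval F x (w j).
Proof.
rewrite /dpeval exchange_big; apply: eq_bigr => j _.
by rewrite ffunE mulr_sumr.
Qed.

Definition line x w (t : T) : {poly K} := (x t)%:P + w t *: 'X.

Lemma line0 x w : [ffun t => (line x w t).[0]] = x.
Proof. by apply/ffunP => t; rewrite ffunE !hornerE. Qed.

(** Both sides are linear in [F] and satisfy the Leibniz rule at [x], so it suffices to compare them
    on 1 and on the variables. *)
Lemma deriv_along_line F x w : (along (line x w) F)^`().[0] = dpeval F x w.
Proof.
pose OK F := (along (line x w) F)^`().[0] = dpeval F x w.
have alongM G H : along (line x w) (G * H) = along (line x w) G * along (line x w) H.
  exact: rmorphM.
have OK1 : OK 1.
  by rewrite /OK dpeval1 /along rmorph1 -polyC1 derivC horner0.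
have OKM G H : OK G -> OK H -> OK (G * H).
  rewrite /OK alongM derivM hornerD !hornerM !horner_along line0 => -> ->.
  by rewrite dpevalM.
have OKX j : OK 'X_j.
  rewrite /OK dpevalX /along mmapX mmap1U /line derivD derivC derivZ derivX.
  by rewrite !hornerE.
have OKm (m : 'X_{1..#|T|}) : OK 'X_[m].
  rewrite mpolyXE_id; apply: big_ind => // j _.
  by elim: (m j) => [|k IHk]; rewrite ?expr0 // exprS; apply: OKM.
elim/mpolyind: F => [|c m F _ _].
  by rewrite /along rmorph0 deriv0 horner0 -(scale0r 1) dpevalZ mul0r.
rewrite dpevalD dpevalZ -(OKm m) => <-.
by rewrite /along mmapD mmapZ mul_polyC derivD derivZ hornerD hornerZ.
Qed.

(* A line lying in X up to finitely many points is tangent to X. *)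
Lemma line_tangent (X : affine_space K T -> Prop) x w (r : {poly K}) :
  r != 0 -> (forall e, r.[e] != 0 -> X [ffun t => x t + e * w t]) ->
  embedded_tangent_space X x w.
Proof.
move=> r0 Xe d F _ FX; rewrite -/(dpeval F x w) -deriv_along_line.
rewrite (_ : along _ _ = 0) ?deriv0 ?horner0 //; apply: poly_fun_eq0 => e.
rewrite horner_along; apply: peval_generic r0 _ e => e re; apply: FX.
have := Xe e re; congr X; apply/ffunP => t.
by rewrite !ffunE /line !hornerE mulrC.
Qed.

End Derivatives.

(** * Tangent spaces of the Segre variety *)

Section Segre.
Variables (K : numFieldType) (n : nat).
Implicit Types (a b : 'I_n -> bool -> K) (I J : {set 'I_n}).

Definition seg a : affine_space K {set 'I_n} :=
  [ffun I : {set 'I_n} => \prod_i a i (i \in I)].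

Definition upd a b (i : 'I_n) : 'I_n -> bool -> K :=
  fun j => if j == i then b j else a j.

Definition scale_fam (c : K) b : 'I_n -> bool -> K := fun i e => c * b i e.

(* c a_1 (x) ... (x) a_n + \sum_i a_1 (x) ... (x) b_i (x) ... (x) a_n. *)
Definition tangent_point (c : K) a b : affine_space K {set 'I_n} :=
  [ffun I => c * seg a I + \sum_i seg (upd a b i) I].

Lemma tangent_pointE c a b I :
  tangent_point c a b I = c * seg a I + \sum_i seg (upd a b i) I.
Proof. exact: ffunE. Qed.

Definition decomposable a : Prop := forall i, exists e, a i e != 0.

Lemma segre_seg a : decomposable a -> @segre K n (seg a).
Proof. by move=> a0; exists a; split=> // I; rewrite ffunE. Qed.

Lemma seg_updE a b i I :
  seg (upd a b i) I = b i (i \in I) * \prod_(j | j != i) a j (j \in I).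
Proof.
rewrite ffunE (bigD1 i) //= /upd eqxx; congr (_ * _).
by apply: eq_bigr => j /negPf ->.
Qed.

Lemma segE a i I : seg a I = a i (i \in I) * \prod_(j | j != i) a j (j \in I).
Proof. by rewrite ffunE (bigD1 i). Qed.

Lemma seg_upd_scale a b c i I : seg (upd a (scale_fam c b) i) I = c * seg (upd a b i) I.
Proof. by rewrite !seg_updE mulrA. Qed.

Lemma tangent_point_scale c x a b :
  [ffun I => x * tangent_point c a b I] = tangent_point (x * c) a (scale_fam x b).
Proof.
apply/ffunP => I; rewrite ffunE !tangent_pointE mulrDr mulrA mulr_sumr; congr (_ + _).
by apply: eq_bigr => i _; rewrite seg_upd_scale.
Qed.

(** Replacing the [i]-th factor [a_i] by [a_i + e b_i] describes a line, which lies in the Segre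
    variety wherever the coordinate [e0] of the moving factor is nonzero. *)
Lemma seg_upd_tangent a b i : decomposable a ->
  embedded_tangent_space (@segre K n) (seg a) (seg (upd a b i)).
Proof.
move=> a0; have [e0 ae0] := a0 i.
apply: (@line_tangent _ _ _ _ _ ((a i e0)%:P + b i e0 *: 'X)).
  by apply: contraNneq ae0 => /(congr1 (horner^~ 0)); rewrite !hornerE => ->.
move=> e; rewrite !hornerE => re.
exists (upd a (fun j f => a j f + e * b j f) i); split.
  move=> j; rewrite /upd; case: eqVneq => [->|_]; last exact: a0.
  by exists e0; rewrite mulrC.
move=> I; rewrite ffunE (segE a i) seg_updE.
have := seg_updE a (fun j f => a j f + e * b j f) i I; rewrite ffunE => ->.
by rewrite mulrA -mulrDl.
Qed.

Lemma tangent_point_tangent c a b : (0 < n)%N -> decomposable a ->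
  embedded_tangent_space (@segre K n) (seg a) (tangent_point c a b).
Proof.
move=> n0 a0 d F Fd FX; rewrite -/(dpeval F _ _).
pose i0 := Ordinal n0.
(* The multiple [c] of [seg a] is absorbed into the summand of one chosen factor. *)
pose b' i e := b i e + (i == i0)%:R * c * a i e.
have -> : tangent_point c a b = [ffun I => \sum_i seg (upd a b' i) I].
  apply/ffunP => I; rewrite tangent_pointE [RHS]ffunE [LHS]addrC.
  rewrite [RHS](eq_bigr (fun i => seg (upd a b i) I + (i == i0)%:R * (c * seg a I))).
    rewrite big_split /=; congr (_ + _); rewrite [RHS](bigD1 i0) //= mul1r.
    by rewrite big1 ?addr0 // => i /negPf ->; rewrite mul0r.
  by move=> i _; rewrite !seg_updE (segE a i) /b'; ring.
rewrite dpeval_sum big1 // => i _; exact: (seg_upd_tangent _ _ a0 Fd FX).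
Qed.

Definition toggle (i : 'I_n) I : {set 'I_n} := if i \in I then I :\ i else i |: I.

Lemma in_toggle i j I : (j \in toggle i I) = (if j == i then j \notin I else j \in I).
Proof.
rewrite /toggle; case: ifP => iI; rewrite !inE; case: eqP => [->|//=].
  by rewrite iI.
by rewrite iI.
Qed.

(** This is the differential of [p_I p_J - p_I' p_J'], where [I'] and [J'] are the toggled sets. The
    quadric vanishes on rank-one tensors, since toggling exchanges the two entries of the [i]-th
    factor. *)
Lemma segre_quadric i I J x y : (i \in I) != (i \in J) ->
  embedded_tangent_space (@segre K n) x y ->
  y I * x J + x I * y J
  = y (toggle i I) * x (toggle i J) + x (toggle i I) * y (toggle i J).
Proof.
move=> iIJ Ty.
pose X (L : {set 'I_n}) : {mpoly K[#|{: {set 'I_n}}|]} := 'X_(enum_rank L).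
pose F := X I * X J + (-1) *: (X (toggle i I) * X (toggle i J)).
have XX2 L M : X L * X M \is 2.-homog.
  by rewrite -[2%N]/(1 + 1)%N; apply: dhomogM; rewrite dhomogX; apply/eqP/mdeg1.
have F2 : F \is 2.-homog by apply: rpredD => //; apply: rpredZ.
have /(Ty _ F F2) : vanishes_on F (@segre K n).
  move=> v [a [_ E]]; rewrite /F pevalD pevalZ !pevalM !pevalU !E mulN1r.
  apply/eqP; rewrite subr_eq0 -!big_split /=; apply/eqP/eq_bigr => j _.
  rewrite !in_toggle; case: eqP => [->|//].
  by move: iIJ; case: (i \in I); case: (i \in J) => //= _; rewrite mulrC.
rewrite -/(dpeval F x y) dpevalD dpevalZ !dpevalM !dpevalX !enum_rankK !pevalU mulN1r.
by move/eqP; rewrite subr_eq0 => /eqP.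
Qed.

(** Induction on the number of elements in which [J] differs from [I0]. For such an element [i], all
    terms of the quadric relation but [x I0 * d J] vanish. *)
Lemma tangent_vector_eq0 I0 x d :
  embedded_tangent_space (@segre K n) x d -> x I0 != 0 ->
  d I0 = 0 -> (forall i, d (toggle i I0) = 0) -> forall J, d J = 0.
Proof.
move=> Td x0 d0 di J; pose D (J : {set 'I_n}) := [set i | (i \in I0) != (i \in J)].
have [k] := ubnP #|D J|; elim: k J => // k IHk J; rewrite ltnS => Dk.
have [DJ|[i iD]] := set_0Vmem (D J).
  suff -> : J = I0 by [].
  apply/setP => i; have /setP/(_ i) := DJ; rewrite !inE.
  by case: eqP => // ->.
have : (#|D (toggle i J)| < #|D J|)%N.
  apply: proper_card; apply/properP; split.
    apply/subsetP => j; rewrite !inE in_toggle.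
    by case: (eqVneq j i) => [->|] //; move: iD; rewrite inE => ->.
  exists i => //; rewrite !inE in_toggle eqxx negbK.
  by move: iD; rewrite inE; case: (i \in I0); case: (i \in J).
move=> /leq_trans/(_ Dk)/IHk dt.
have iIJ : (i \in I0) != (i \in J) by move: iD; rewrite inE.
have := segre_quadric iIJ Td; rewrite d0 di dt !mul0r !mulr0 !add0r.
by move/eqP; rewrite mulf_eq0 (negPf x0) => /eqP.
Qed.

(** By [tangent_vector_eq0], a tangent vector is determined by its entries at [I0] and at the [n]
    neighbours of [I0]; [c] and [b] are chosen to match them. *)
Lemma tangent_spaceP a y : (0 < n)%N -> decomposable a ->
  embedded_tangent_space (@segre K n) (seg a) y ->
  exists c b, y = tangent_point c a b.
Proof.
move=> n0 a0 Ty; pose I0 := [set i | a i true != 0].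
have aI0 i : a i (i \in I0) != 0.
  rewrite inE; have [ai|//] := eqVneq (a i true) 0.
  by have [[]] := a0 i; rewrite // ai eqxx.
have x0 : seg a I0 != 0 by rewrite ffunE; apply/prodf_neq0.
pose c := y I0 / seg a I0.
(* Since [b i] vanishes on the coordinate used by [I0], the entry at [I0] involves [c] alone, and
   the entry at [toggle i I0] involves only [c] and [b i]. *)
pose b i e := if e == (i \in I0) then 0 else
  (y (toggle i I0) - c * seg a (toggle i I0)) / \prod_(j | j != i) a j (j \in I0).
exists c, b; set w := tangent_point c a b.
have Tw : embedded_tangent_space (@segre K n) (seg a) w by apply: tangent_point_tangent.
pose d : affine_space K {set 'I_n} := [ffun I => y I - w I].
have Td : embedded_tangent_space (@segre K n) (seg a) d.
  move=> k F Fk FX; transitivity (dpeval F (seg a) y - dpeval F (seg a) w).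
    by rewrite -sumrB; apply: eq_bigr => j _; rewrite ffunE mulrBr.
  by rewrite /dpeval (Ty k F) // (Tw k F) // subrr.
suff d0 J : d J = 0.
  by apply/ffunP => J; have := d0 J; rewrite ffunE => /eqP; rewrite subr_eq0 => /eqP.
apply: (tangent_vector_eq0 Td x0) => [|k]; rewrite ffunE [w _]tangent_pointE.
  rewrite /c divfK // big1 ?addr0 ?subrr // => i _.
  by rewrite seg_updE /b eqxx mul0r.
rewrite (bigD1 k) //= [X in _ + (_ + X)]big1 ?addr0 => [|i ik]; last first.
  by rewrite seg_updE in_toggle (negPf ik) /b eqxx mul0r.
rewrite seg_updE in_toggle eqxx /b ifN; last by case: (k \in I0).
have -> : \prod_(j | j != k) a j (j \in toggle k I0)
        = \prod_(j | j != k) a j (j \in I0).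
  by apply: eq_bigr => j jk; rewrite in_toggle (negPf jk).
rewrite divfK; first by ring.
by apply/prodf_neq0 => j _.
Qed.

Lemma tangent_lineP z : (0 < n)%N -> on_tangent_line (@segre K n) z ->
  exists c a b, z = tangent_point c a b.
Proof.
move=> n0 [_ [x [y [[a [a0 xa]] Ty _ [u [v zE]]]]]].
have xE : x = seg a by apply/ffunP => I; rewrite xa ffunE.
move: Ty; rewrite xE => /(tangent_spaceP n0 a0)[c [b yE]].
exists (u + v * c), a, (scale_fam v b); apply/ffunP => I.
rewrite zE xE yE !tangent_pointE mulrDr mulrDl mulrA mulr_sumr addrA; congr (_ + _).
by apply: eq_bigr => i _; rewrite seg_upd_scale.
Qed.

End Segre.

(** * Moments and cumulants of points on tangent lines *)

Section TangentCumulants.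
Variables (K : numFieldType) (n : nat).
Implicit Types (a b : 'I_n -> bool -> K) (I J : {set 'I_n}).

(* The linear map induced on each factor by the passage to moments. *)
Definition shear a : 'I_n -> bool -> K :=
  fun i e => if e then a i true else a i false + a i true.

(** Expand the product of the sums [a i true + a i false], where the second term is dropped for
    [i \in I]: exactly the sets containing [I] survive. *)
Lemma moment_seg a I : moment (seg a) I = seg (shear a) I.
Proof.
rewrite ffunE (eq_bigr (fun i => a i true + (if i \in I then 0 else a i false))).
  rewrite bigA_distr /moment big_mkcond; apply: eq_bigr => J _; case: ifP => IJ.
    rewrite ffunE; apply: eq_bigr => i _; case: ifP => // iJ.
    by rewrite ifN //; apply: contraFN iJ => /(subsetP IJ).
  have /subsetPn[i iI iJ] := negbT IJ.
  by rewrite (bigD1 i) //= (negPf iJ) iI mul0r.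
by move=> i _; rewrite /shear; case: ifP; rewrite ?addr0 // addrC.
Qed.

Lemma shear_upd a b i I : seg (shear (upd a b i)) I = seg (upd (shear a) (shear b) i) I.
Proof. by rewrite !ffunE; apply: eq_bigr => j _; rewrite /shear /upd; case: eqP. Qed.

Lemma moment_tangent_point c a b I :
  moment (tangent_point c a b) I = tangent_point c (shear a) (shear b) I.
Proof.
rewrite tangent_pointE -moment_seg /moment mulr_sumr.
under eq_bigr do rewrite tangent_pointE.
rewrite big_split /= exchange_big; congr (_ + _); apply: eq_bigr => i _.
by rewrite -shear_upd -moment_seg.
Qed.

Definition seg_gf a : {mpoly K[n]} := \prod_i ((a i false)%:MP + a i true *: 'X_i).

Lemma sum_seg_gf a : \sum_I seg a I *: \prod_(i in I) 'X_i = seg_gf a.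
Proof.
rewrite /seg_gf; under [RHS]eq_bigr do rewrite addrC.
rewrite bigA_distr; apply: eq_bigr => I _.
rewrite ffunE -mul_mpolyC rmorph_prod /= [X in _ * X]big_mkcond -big_split /=.
by apply: eq_bigr => i _; case: ifP; rewrite ?mulr1 // mul_mpolyC.
Qed.

Lemma moment_gf_tangent_point c a b :
  moment_gf (tangent_point c a b)
  = c *: seg_gf (shear a) + \sum_i seg_gf (upd (shear a) (shear b) i).
Proof.
rewrite -sum_seg_gf scaler_sumr; under [X in _ + X]eq_bigr do rewrite -sum_seg_gf.
rewrite exchange_big /= -big_split; apply: eq_bigr => I _ /=.
by rewrite moment_tangent_point tangent_pointE scalerDl -scalerA scaler_suml.
Qed.

Lemma moment_gf0 (p : affine_space K {set 'I_n}) : (moment_gf p)@_0%MM = moment p set0.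
Proof.
rewrite /moment_gf raddf_sum (bigD1 set0) //= [X in _ + X]big1 => [|I I0].
  by rewrite big_set0 mcoeffZ mcoeff1 eqxx mulr1 addr0.
rewrite mcoeffZ mprodXE mcoeffX -mdeg_eq0 mdeg_sum.
have /set0Pn[i iI] := I0; rewrite (bigD1 i) //= mdeg1.
by rewrite mulr0.
Qed.

Definition unit_gf (u : 'I_n -> K) : {mpoly K[n]} := \prod_i (1 + u i *: 'X_i).

Lemma unit_gf0 u : (unit_gf u)@_0%MM = 1.
Proof.
rewrite /unit_gf rmorph_prod /= big1 // => i _.
by rewrite mcoeffD mcoeff1 eqxx mcoeffZ mcoeffX mnm1_eq0 mulr0 addr0.
Qed.

Lemma theta_unit_gf u i : sqnull (theta i (unit_gf u) - u i *: 'X_i * unit_gf u).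
Proof.
have thE j : theta i (1 + u j *: 'X_j) = if i == j then u j *: 'X_j else 0.
  by rewrite thetaD theta1 add0r thetaZ thetaU; case: ifP; rewrite ?scaler0.
rewrite /unit_gf (bigD1 i) //=; set q := \prod_(j | _) _.
have q0 : theta i q = 0.
  rewrite /q; elim/big_ind: _ => [|x y hx hy|j /negPf ji]; first exact: theta1.
    by rewrite thetaM hx hy mul0r mulr0 addr0.
  by rewrite thE eq_sym ji.
rewrite thetaM q0 thE eqxx mulr0 addr0.
have -> : u i *: 'X_i * q - u i *: 'X_i * ((1 + u i *: 'X_i) * q)
        = - ('X_i ^+ 2 * (u i ^+ 2 *: q)).
  by rewrite -!mul_mpolyC rmorphXn /=; ring.
exact/sqnullN/sqnullM/sqnull_sqr.
Qed.

(** The coefficient of [x_i] in [(B_i false + B_i true x_i) / (1 + u_i x_i)], with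
    [u_i = A_i true / A_i false], times the constant terms of the other factors. *)
Definition tangent_slope (A B : 'I_n -> bool -> K) (i : 'I_n) : K :=
  (\prod_(j | j != i) A j false) * (B i true - A i true / A i false * B i false).

Lemma gf_factor c (A B : 'I_n -> bool -> K) :
  (forall j, A j false != 0) ->
  exists k, sqnull (c *: seg_gf A + \sum_i seg_gf (upd A B i)
    - unit_gf (fun i => A i true / A i false) * (k%:MP + lin_form (tangent_slope A B))).
Proof.
move=> A0; pose u i := A i true / A i false; rewrite -/u.
have AE j : (A j false)%:MP + A j true *: 'X_j = (A j false)%:MP * (1 + u j *: 'X_j).
  rewrite mulrDr mulr1 -[u j *: _]mul_mpolyC mulrA -mpolyCM.
  by rewrite [A j false * u j]mulrC divfK // mul_mpolyC.
pose N := \prod_i A i false; pose M i := \prod_(j | j != i) A j false.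
pose Q i := \prod_(j | j != i) (1 + u j *: 'X_j).
have segE' : seg_gf A = N%:MP * unit_gf u.
  rewrite /seg_gf (eq_bigr _ (fun j _ => AE j)) big_split /=.
  by rewrite /N rmorph_prod.
have updE i : seg_gf (upd A B i)
    = (M i)%:MP * ((B i false)%:MP + B i true *: 'X_i) * Q i.
  rewrite /seg_gf (bigD1 i) //= /upd eqxx.
  rewrite (eq_bigr (fun j => (A j false)%:MP * (1 + u j *: 'X_j))) => [|j /negPf ->].
    by rewrite big_split /= /M rmorph_prod /= mulrCA mulrA.
  exact: AE.
have unitE i : unit_gf u = (1 + u i *: 'X_i) * Q i by rewrite /unit_gf (bigD1 i).
(* The sum of the constant terms of all summands. *)
exists (c * N + \sum_i M i * B i false).
have -> : c *: seg_gf A + \sum_i seg_gf (upd A B i)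
    - unit_gf u * ((c * N + \sum_i M i * B i false)%:MP + lin_form (tangent_slope A B))
  = \sum_i - ('X_i ^+ 2 * ((M i * u i * (B i true - u i * B i false)) *: Q i)).
  rewrite mpolyCD rmorph_sum /= segE' mulrDr mulrDr mpolyCM -mul_mpolyC.
  have cancel (x y z w v l : {mpoly K[n]}) :
      x * (y * z) + w - (z * (x * y) + z * v + z * l) = w - z * v - z * l by ring.
  rewrite cancel.
  rewrite /lin_form !mulr_sumr -!sumrB; apply: eq_bigr => i _.
  rewrite updE (unitE i) /tangent_slope -/(M i) -/(u i) -!mul_mpolyC !(mpolyCM, mpolyCB).
  by ring.
by apply: sqnull_sum => i; apply/sqnullN/sqnullM/sqnull_sqr.
Qed.

Lemma cumulant_tangent_point c a b I :
  (forall j, shear a j false != 0) -> moment (tangent_point c a b) set0 = 1 ->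
  (1 < #|I|)%N ->
  cumulant (tangent_point c a b) I
  = cumulant_factor K I * \prod_(i in I) tangent_slope (shear a) (shear b) i.
Proof.
move=> a0 m1 I1; have f0 := moment_gf0 (tangent_point c a b); rewrite m1 in f0.
have [k hk] := gf_factor c (shear b) a0.
rewrite -moment_gf_tangent_point in hk.
(* Comparison of constant terms, using that [mu_0] is 1. *)
have k1 : k = 1.
  have := hk set0; rewrite sqfree0 mcoeffB f0 rmorphM /= unit_gf0 mcoeffD lin_form0.
  by rewrite mcoeffC eqxx mulr1 addr0 mul1r => /eqP; rewrite subr_eq0 => /eqP.
rewrite k1 mpolyC1 in hk.
have t0 : (1 + lin_form (tangent_slope (shear a) (shear b)))@_0%MM = 1.
  by rewrite mcoeffD lin_form0 mcoeff1 eqxx addr0.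
apply: etrans (trunc_log_lin_form _ (ltnW I1)).
exact: (trunc_log_shift f0 t0 (theta_unit_gf _) hk).
Qed.

(** This turns an equation between higher cumulants into a polynomial condition on the table, which
    can be tested on a closure. *)
Lemma cumulant_polyfun I : polyfun (fun p => @cumulant K n p I).
Proof.
pose cpf (F : affine_space K {set 'I_n} -> {mpoly K[n]}) :=
  forall m, polyfun (fun p => (F p)@_m).
have cM F G : cpf F -> cpf G -> cpf (fun p => F p * G p).
  move=> hF hG m; apply: eq_polyfun (fun p => esym (mcoeffM _ _ _)) _.
  by apply: polyfun_sum => k; apply: polyfunM.
have cX F k : cpf F -> cpf (fun p => F p ^+ k).
  move=> hF; elim: k => [|k IHk] m.
    by apply: (eq_polyfun (f := fun=> (1 : {mpoly K[n]})@_m)) (polyfun_const _ _).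
  by apply: eq_polyfun (cM _ _ hF IHk m) => p; rewrite exprS.
have c1 : cpf (fun p => moment_gf p - 1).
  move=> m; apply: (eq_polyfun (f := fun p => \sum_(I : {set 'I_n})
      moment p I * (\prod_(i in I) 'X_i : {mpoly K[n]})@_m + (- (1 : {mpoly K[n]})@_m))).
    move=> p; rewrite mcoeffB /moment_gf raddf_sum; congr (_ - _).
    by apply: eq_bigr => J _; rewrite /= mcoeffZ.
  apply: polyfunD (polyfun_const _ _); apply: polyfun_sum => J.
  apply: polyfunM (polyfun_const _ _); apply: polyfun_sum => L.
  exact: polyfun_coord.
apply: (eq_polyfun (f := fun p => \sum_(1 <= m < n.+1)
    ((-1) ^+ m.-1 / m%:R) * ((moment_gf p - 1) ^+ m)@_(sqfree I))).
  move=> p; rewrite /cumulant /Defs.trunc_log raddf_sum.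
  by apply: eq_bigr => k _; rewrite /= mcoeffZ.
by apply: polyfun_sum => k; apply: polyfunM (polyfun_const _ _) (cX _ _ c1 _).
Qed.

(* A polynomial is tested on the tangent points over the chart
   shear a i false != 0 only; the others are reached by perturbing the
   coordinates a i false. *)
Lemma tangential_chart (G : {mpoly K[#|{: {set 'I_n}}|]}) p :
  (0 < n)%N ->
  (forall c a b, (forall j, shear a j false != 0) ->
    moment (tangent_point c a b) set0 = 1 -> peval G (tangent_point c a b) = 0) ->
  tangential_variety (@segre K n) p -> moment p set0 = 1 -> peval G p = 0.
Proof.
move=> n0 hG [_ pcl] p1.
(* The moment [mu_0] as a linear form. *)
pose L : {mpoly K[#|{: {set 'I_n}}|]} := \sum_J 'X_(enum_rank J).
have LE v : peval L v = moment v set0.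
  rewrite peval_sum /moment; apply: eq_big => J; first by rewrite sub0set.
  by rewrite pevalU.
have L1 : L \is 1.-homog.
  by apply: rpred_sum => J _; rewrite dhomogX; apply/eqP; exact: mdeg1.
have [d [F [Fd F0 FE]]] := homogenize G L1.
have Fgen c a b : (forall j, shear a j false != 0) -> peval F (tangent_point c a b) = 0.
  move=> a0; have [/F0 //|L0] := eqVneq (peval L (tangent_point c a b)) 0.
  rewrite FE //; set x := _^-1; rewrite tangent_point_scale hG ?mulr0 //.
  rewrite -tangent_point_scale -LE (peval_homog _ _ L1) expr1 mulVf //.
have Fall c a b : peval F (tangent_point c a b) = 0.
  pose aX i (e : bool) : {poly K} := (a i e)%:P + (if e then 0 else 'X).
  pose h (I : {set 'I_n}) : {poly K} := c *: \prod_i aX i (i \in I)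
    + \sum_i b i (i \in I) *: \prod_(j | j != i) aX j (j \in I).
  pose ae e i (f : bool) : K := a i f + (if f then 0 else e).
  have aXE e i f : (aX i f).[e] = ae e i f.
    by rewrite /aX /ae hornerD hornerC; case: f; rewrite ?horner0 ?hornerX.
  have hE e : [ffun I => (h I).[e]] = tangent_point c (ae e) b.
    apply/ffunP => I; rewrite ffunE tangent_pointE hornerD hornerZ horner_prod.
    rewrite horner_sum ffunE; congr (_ * _ + _); apply: eq_bigr => i _; first by rewrite aXE.
    rewrite seg_updE hornerZ horner_prod; congr (_ * _).
    by apply: eq_bigr => j _; rewrite aXE.
  (* Perturbing every [a i false] by [e] adds [e] to its shear, so the roots of [r] are the
     parameters outside the chart. *)
  pose r : {poly K} := \prod_j ((shear a j false)%:P + 'X).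
  have r0 : r != 0.
    apply/prodf_neq0 => j _; rewrite -size_poly_eq0 addrC size_XaddC //.
  have H := peval_generic (P := F) (h := h) r0.
  have <- : tangent_point c (ae 0) b = tangent_point c a b.
    have ae0 i f : ae 0 i f = a i f by rewrite /ae; case: f; rewrite addr0.
    apply/ffunP => I; rewrite !tangent_pointE !ffunE; congr (_ * _ + _).
      by apply: eq_bigr => i _; rewrite ae0.
    apply: eq_bigr => i _; rewrite !ffunE; apply: eq_bigr => j _.
    by rewrite /upd; case: eqP.
  rewrite -hE; apply: H => e re; rewrite hE; apply: Fgen => j.
  move: re; rewrite horner_prod => /prodf_neq0/(_ j isT).
  by rewrite hornerD hornerC hornerX /shear /ae addr0 addrAC.
have Fp : peval F p = 0.
  by apply: (pcl _ F Fd) => z /(tangent_lineP n0)[c [a [b ->]]]; apply: Fall.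
have := FE p; rewrite LE p1 expr1n mul1r Fp => /(_ (oner_neq0 _)) E; rewrite [RHS]E.
by congr peval; apply/ffunP => J; rewrite ffunE invr1 mul1r.
Qed.

Definition base_fam : 'I_n -> bool -> K := fun _ e => (~~ e)%:R.

(** The sign makes the sheared vector [(0, s i)]: [mu_0] stays 1 and the slopes are the [s i]. *)
Definition slope_fam (s : 'I_n -> K) : 'I_n -> bool -> K :=
  fun i e => if e then s i else - s i.

Lemma shear_base i e : shear base_fam i e = (~~ e)%:R.
Proof. by case: e => //=; rewrite addr0. Qed.

Lemma shear_slope s i e : shear (slope_fam s) i e = if e then s i else 0.
Proof. by case: e => //=; rewrite addNr. Qed.

Lemma moment_base_point s : moment (tangent_point 1 base_fam (slope_fam s)) set0 = 1.
Proof.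
rewrite moment_tangent_point tangent_pointE big1 => [|i _].
  by rewrite addr0 mul1r ffunE big1 // => i _; rewrite inE shear_base.
by rewrite seg_updE inE shear_slope mul0r.
Qed.

Lemma cumulant_base_point s I : (1 < #|I|)%N ->
  cumulant (tangent_point 1 base_fam (slope_fam s)) I
  = cumulant_factor K I * \prod_(i in I) s i.
Proof.
move=> I1; rewrite cumulant_tangent_point ?moment_base_point //; last first.
  by move=> j; rewrite shear_base oner_neq0.
congr (_ * _); apply: eq_bigr => i _; rewrite /tangent_slope !shear_slope mulr0 subr0.
by rewrite big1 ?mul1r // => j _; rewrite shear_base.
Qed.

Lemma base_point_tangential s : (0 < n)%N ->
  tangential_variety (@segre K n) (tangent_point 1 base_fam (slope_fam s)).
Proof.
move=> n0; set z := tangent_point _ _ _.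
have znz : nonzero z.
  apply: NNPP => nz; have := moment_base_point s; rewrite -/z /moment big1.
    by move/esym/eqP; rewrite oner_eq0.
  by move=> J _; apply/eqP/negP => /negP zJ; apply: nz; exists J.
(* For [s = 0] the direction would be zero and span no line; any nonzero [s'] with multiplier 0 then
   serves. *)
have [be [s' [i s'i sE]]] : exists (be : K) (s' : 'I_n -> K),
    exists2 i, s' i != 0 & forall j, s j = be * s' j.
  case: (classic (exists i, s i != 0)) => [[i si]|ns].
    by exists 1, s, i => // j; rewrite mul1r.
  exists 0, (fun=> 1), (Ordinal n0); rewrite ?oner_neq0 // => j; rewrite mul0r.
  by apply/eqP/negP => /negP sj; apply: ns; exists j.
have dec : decomposable base_fam by move=> j; exists false; rewrite oner_neq0.
pose y := tangent_point 0 base_fam (slope_fam s').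
have on_line : on_tangent_line (@segre K n) z.
  split=> //; exists (seg base_fam), y; split.
  - exact: segre_seg.
  - exact: tangent_point_tangent.
  (* Independence is read off at the entries [[set i]] and [set0]. *)
  - have seg1 : seg base_fam [set i] = 0.
      by rewrite (segE _ i) in_set1 eqxx mul0r.
    have y1 : y [set i] = s' i.
      rewrite tangent_pointE mul0r add0r (bigD1 i) //= big1 ?addr0 => [|k ki].
        rewrite seg_updE in_set1 eqxx big1 ?mulr1 // => j ji.
        by rewrite in_set1 (negPf ji).
      rewrite seg_updE (bigD1 i) /=; last by rewrite eq_sym.
      by rewrite !in_set1 eqxx mul0r mulr0.
    move=> u v uv; have := uv [set i]; rewrite seg1 mulr0 add0r y1 => /eqP.
    rewrite mulf_eq0 (negPf s'i) orbF => /eqP v0; split=> //.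
    have := uv set0; rewrite v0 mul0r addr0 ffunE big1 ?mulr1 // => j _.
    by rewrite inE.
  - exists 1, be => I; rewrite !tangent_pointE mul0r add0r mulr_sumr; congr (_ + _).
    apply: eq_bigr => j _; rewrite !seg_updE mulrA; congr (_ * _).
    by rewrite /slope_fam; case: (j \in I); rewrite sE // mulrN.
by split=> // d F _; apply.
Qed.

End TangentCumulants.

(** * The isomorphism and the conclusion *)

Lemma tangential_cumulant_isomorphic (K : numFieldType) (n : nat) : (0 < n)%N ->
  isomorphic (@tangential_cumulant_variety K n) (@squarefree_toric_variety K n).
Proof.
move=> n0; pose H := higher_index n.
pose c (I : H) : K := cumulant_factor K (val I).
have c0 I : c I != 0 by rewrite cumulant_factor_neq0 // ltnW // (valP I).
pose f (I : H) : {mpoly K[#|H|]} := (c I)^-1 *: 'X_(enum_rank I).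
pose g (I : H) : {mpoly K[#|H|]} := c I *: 'X_(enum_rank I).
have fE v I : polynomial_map f v I = (c I)^-1 * v I by rewrite ffunE pevalZ pevalU.
have gE v I : polynomial_map g v I = c I * v I by rewrite ffunE pevalZ pevalU.
have polyH (k : H -> {mpoly K[#|H|]}) P : polyfun (fun v => peval P (polynomial_map k v)).
  by apply: polyfun_comp => I; exists (k I) => v; rewrite ffunE.
exists f, g; split.
- move=> x Xx P PS; have [Q QE] := polyH f P; rewrite -QE.
  apply: Xx => _ [p [Tp p1 ->]]; rewrite QE.
  (* The condition is pulled back to tables, where [tangential_chart] reduces it to tangent points
     with known cumulants. *)
  have [G GE] : polyfun (fun p => peval P (polynomial_map f (@higher_cumulants K n p))).
    apply: polyfun_comp => I; apply: eq_polyfun (fun p => esym (fE _ _)) _.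
    apply: polyfunM (polyfun_const _ _) _.
    by apply: eq_polyfun (cumulant_polyfun K (val I)) => q; rewrite ffunE.
  rewrite -GE; apply: tangential_chart Tp p1 => // k a b a0 m1; rewrite GE; apply: PS.
  exists (tangent_slope (shear a) (shear b)); apply/ffunP => I.
  rewrite fE !ffunE cumulant_tangent_point ?(valP I) // mulKf //.
- move=> y Yy P PS; have [Q QE] := polyH g P; rewrite -QE.
  apply: Yy => _ [s ->]; rewrite QE; apply: PS.
  exists (tangent_point 1 (@base_fam K n) (slope_fam s)); split.
  + exact: base_point_tangential.
  + exact: moment_base_point.
  + by apply/ffunP => I; rewrite gE !ffunE cumulant_base_point // (valP I).
- by move=> x _; apply/ffunP => I; rewrite gE fE mulVKf.
- by move=> y _; apply/ffunP => I; rewrite fE gE mulKf.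
Qed.

Theorem theorem4p1 (R : realType) (n : nat) (n_gt0 : (0 < n)%N) :
  isomorphic (@tangential_cumulant_variety R[i] n)
             (@squarefree_toric_variety R[i] n) /\
  ((2 < n)%N -> has_dimension (@squarefree_toric_variety R[i] n) n).
Proof.
split; first exact: tangential_cumulant_isomorphic.
exact: squarefree_toric_dimension.
Qed.
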